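(* Let $(\bar{x},\bar{y})\in X_{\rm LP}$. Suppose that $T=\{1\}$, that $a_q\le b_1$ for all $q\in Q$, that $b_1r+c<a_q$ for all $q\in Q$, and that $$\sum_{q\in Q}a_q\le b_1(r+1)+c.$$ Then the inequality $x_d\le y_1-r$ solves the separation problem for $(\bar{x},\bar{y})$. Moreover, it defines a facet of the polyhedron $P$.
   Context: $Q$ is a nonempty finite set, $T=\{1\}$, $b_1>0$, $a_q>0$ for all $q\in Q$, $c\in\mathbb{R}$, and $\sum_{q\in Q}a_q-c>0$. The unsplittable flow arc-set is $$X=\Big\{(x,y)\in\{0,1\}^{|Q|}\times\mathbb{Z}_+^{|T|}:\ \sum_{q\in Q}a_qx_q\le\sum_{t\in T}b_ty_t+c\Big\},$$ $P=\mathrm{conv}(X)$, and $X_{\rm LP}=\{(x,y)\in[0,1]^{|Q|}\times\mathbb{R}_+^{|T|}:\sum_{q\in Q}a_qx_q\le\sum_{t\in T}b_ty_t+c\}$. Let $r=\max\{\lceil -c/b_1\rceil,0\}$ and let $d\in\operatorname{argmax}_q\{\bar{x}_q:q\in Q\}$. Separation problem for $(\bar{x},\bar{y})$: with $(x^1,y^1),\ldots,(x^u,y^u)$ the vertices of $P$, $$\max_{\alpha,\beta,\gamma}\ \bar{x}^{\top}\alpha-\bar{y}^{\top}\beta-\gamma\quad\text{s.t.}\quad (x^k)^{\top}\alpha-(y^k)^{\top}\beta-\gamma\le 0\ (k=1,\ldots,u),\quad \beta_1=1,\quad \beta_t\ge 0\ (t\in T\setminus\{1\}),$$ over $(\alpha,\beta,\gamma)\in\mathbb{R}^{|Q|}\times\mathbb{R}^{|T|}\times\mathbb{R}$.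 An inequality $\alpha^{\top}x\le\beta^{\top}y+\gamma$ is said to solve the separation problem if $(\alpha,\beta,\gamma)$ is an optimal solution of this problem. *)

(* Defs.v *)
(* MathComp / MathComp-Analysis *)
From HB Require Import structures.
From mathcomp Require Import all_boot all_order all_algebra.
From mathcomp Require Import classical_sets reals convex.

Set Implicit Arguments.
Unset Strict Implicit.
Unset Printing Implicit Defensive.

Import Order.TTheory GRing.Theory Num.Theory.

Local Open Scope classical_set_scope.
Local Open Scope ring_scope.

Definition conv_hull (R : realType) (V : lmodType R) (X : set V) : set V :=
  smallest (@convex_set R V) X.

(* The vertices of a polyhedron are its extreme points. *)
Definition is_vertex (R : realType) (V : lmodType R) (P : set V) (v : V) : Prop :=
  P v /\
  forall (u w : V) (t : R), P u -> P w -> 0 < t -> t < 1 ->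
    v = t *: u + (1 - t) *: w -> u = v /\ w = v.

Definition affinely_independent (R : realType) (V : vectType R) (s : seq V)
    : bool :=
  if s is p :: s' then free [seq q - p | q <- s'] else true.

(* The maximum number of affinely independent points of S is n + 1; as n is a
   natural number, the empty set has no dimension. *)
Definition has_dim (R : realType) (V : vectType R) (S : set V) (n : nat)
    : Prop :=
  (exists s : seq V,
      [/\ {in s, forall p, S p}, affinely_independent s & size s = n.+1]) /\
  (forall s : seq V,
      {in s, forall p, S p} -> affinely_independent s -> (size s <= n.+1)%N).

(* R^Q x R^T. The regular module R^o (rather than R) makes the library infer
   the vector space structure. *)
Notation arc_space R Q T := ({ffun Q -> R^o} * {ffun T -> R^o})%type.

Definition dotf (R : realType) (I : finType) (u v : I -> R) : R :=
  \sum_i u i * v i.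

(* Integrality and nonnegativity of y together say that each y_t lies in the
   image of nat. *)
Definition arc_set (R : realType) (Q T : finType)
    (a : Q -> R) (b : T -> R) (c : R) : set (arc_space R Q T) :=
  [set z : arc_space R Q T |
    [/\ forall q, (z.1 q = 0) \/ (z.1 q = 1),
        forall t, (z.2 t : R) \is a Num.nat
      & dotf a z.1 <= dotf b z.2 + c]].

Definition arc_polyhedron (R : realType) (Q T : finType)
    (a : Q -> R) (b : T -> R) (c : R) : set (arc_space R Q T) :=
  conv_hull (arc_set a b c).

Definition arc_set_LP (R : realType) (Q T : finType)
    (a : Q -> R) (b : T -> R) (c : R) : set (arc_space R Q T) :=
  [set z : arc_space R Q T |
    [/\ forall q, (0 : R) <= z.1 q <= 1,
        forall t, (0 : R) <= z.2 t
      & dotf a z.1 <= dotf b z.2 + c]].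

(* The triple (alpha, beta, gamma) stands for the inequality
   alpha^T x <= beta^T y + gamma; t1 is the distinguished element 1 of T. *)

Definition separation_feasible (R : realType) (Q T : finType)
    (P : set (arc_space R Q T)) (t1 : T)
    (alpha : Q -> R) (beta : T -> R) (gamma : R) : Prop :=
  [/\ forall v, is_vertex P v -> dotf v.1 alpha - dotf v.2 beta - gamma <= 0,
      beta t1 = 1
    & forall t, t != t1 -> 0 <= beta t].

Definition separation_objective (R : realType) (Q T : finType)
    (zbar : arc_space R Q T)
    (alpha : Q -> R) (beta : T -> R) (gamma : R) : R :=
  dotf zbar.1 alpha - dotf zbar.2 beta - gamma.

Definition solves_separation (R : realType) (Q T : finType)
    (P : set (arc_space R Q T)) (t1 : T) (zbar : arc_space R Q T)
    (alpha : Q -> R) (beta : T -> R) (gamma : R) : Prop :=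
  separation_feasible P t1 alpha beta gamma /\
  forall (alpha' : Q -> R) (beta' : T -> R) (gamma' : R),
    separation_feasible P t1 alpha' beta' gamma' ->
    separation_objective zbar alpha' beta' gamma' <=
      separation_objective zbar alpha beta gamma.

Definition valid_inequality (R : realType) (Q T : finType)
    (P : set (arc_space R Q T))
    (alpha : Q -> R) (beta : T -> R) (gamma : R) : Prop :=
  forall z, P z -> dotf alpha z.1 <= dotf beta z.2 + gamma.

Definition face_of (R : realType) (Q T : finType)
    (P : set (arc_space R Q T))
    (alpha : Q -> R) (beta : T -> R) (gamma : R) : set (arc_space R Q T) :=
  P `&` [set z : arc_space R Q T | dotf alpha z.1 = dotf beta z.2 + gamma].

Definition defines_facet (R : realType) (Q T : finType)
    (P : set (arc_space R Q T))
    (alpha : Q -> R) (beta : T -> R) (gamma : R) : Prop :=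
  valid_inequality P alpha beta gamma /\
  exists n : nat, has_dim P n.+1 /\ has_dim (face_of P alpha beta gamma) n.

(* Main.v *)
Require Import Defs.
From HB Require Import structures.
From mathcomp Require Import all_boot all_order all_algebra.
From mathcomp Require Import classical_sets reals convex.
From mathcomp Require Import unstable interval_inference lra.

Set Implicit Arguments.
Unset Strict Implicit.
Unset Printing Implicit Defensive.

Import Order.TTheory GRing.Theory Num.Theory.

Local Open Scope ring_scope.

(** Write y for the single arc variable. The integer r is the least natural
    number k with b k + c >= 0. At y = r the capacity b r + c lies below every
    a_q, so only x = 0 fits; at y >= r + 1 it is at least the sum of all the
    a_q, so every 0/1 vector x fits. Hence X consists of (0, r) and of all of
    {0,1}^Q x {r+1, r+2, ...}. What the proof uses of P is a sandwich:

    - P lies in the region 0 <= x <= 1, x_q <= y - r for all q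
      ([arc_polyhedron_sub_step]);
    - P contains (0, r) and (1_A, r + 1) for every subset A of Q
      ([arc_polyhedron_empty], [arc_polyhedron_next]).

    Optimality. By the sandwich, (0, r) and the points (1_A, r + 1) with A
    nonempty are vertices of P. Let (alpha, 1, gamma) be feasible for the
    separation problem, S the sum of the positive alpha_q, and m = xbar_d, which
    is the largest entry of xbar. The vertex (0, r) gives - gamma <= r, and the
    vertex (1_A, r + 1) with A = {q : alpha_q > 0} gives S <= r + 1 + gamma.
    Since 0 <= xbar_q <= m <= 1,
      alpha^T xbar - gamma <= m S - gamma <= m (r + 1) - (1 - m) gamma <= m + r,
    and m + r - ybar is the objective value of x_d <= y - r.

    Facet. Based at (0, r), the face x_d = y - r contains the points reached by
    the |Q| directions (1_{d,q}, 1), q in Q, where q = d gives (1_{d}, 1).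
    These together with (0, 1), which leads to the point (0, r + 1) of P, span
    the whole space of dimension |Q| + 1 ([basis_dirs]). They are therefore
    linearly independent, so P has dimension |Q| + 1. The first |Q| of them span
    the hyperplane x_d = y of all differences of points of the face
    ([facet_dirs_span]), so the face has dimension |Q|. *)

(** * Dimension and convexity *)

(** A free family X of directions from one point of S reaches size X + 1
    affinely independent points; no more are possible when all differences of
    points of S stay in the span of X. *)
Lemma has_dim_free (R : realType) (V : vectType R) (S : set V) (p : V)
    (X : seq V) :
  S p -> {in X, forall v, S (p + v)} -> free X ->
  (forall u v, S u -> S v -> v - u \in <<X>>%VS) -> has_dim S (size X).
Proof.
move=> Sp SX freeX diffX; split.
  exists (p :: [seq p + v | v <- X]); split; last by rewrite /= size_map.
  - move=> v; rewrite inE => /predU1P[->//|/mapP[w wX ->]]; exact: SX.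
  - rewrite /= -map_comp map_id_in // => v _ /=; by rewrite addrC addKr.
case=> [//|u s] Ss /= frees; rewrite ltnS.
rewrite -(size_map (fun q => q - u) s) -(eqP frees).
apply: leq_trans (dim_span X); apply/dimvS/span_subvP => _ /mapP[v vs ->].
by apply: diffX; apply: Ss; rewrite inE ?eqxx ?vs ?orbT.
Qed.

Lemma conv_hull_sub (R : realType) (V : lmodType R) (X Y : set V) :
  (X `<=` Y)%classic ->
  (forall u v (s t : R), 0 <= s -> 0 <= t -> s + t = 1 ->
     Y u -> Y v -> Y (s *: u + t *: v)) ->
  (conv_hull X `<=` Y)%classic.
Proof.
move=> XY cvxY; apply: smallest_sub => // u v l /set_mem Yu /set_mem Yv.
apply/mem_set; rewrite /conv /=; apply: cvxY => //.
- by rewrite onem_ge0.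
- exact: add_onemK.
Qed.

(** With [conv_eq_max]: the reason why a point all of whose coordinates are
    extremal over P, possibly after the others are fixed, is a vertex of P. *)
Lemma conv_eq_min (R : realFieldType) (m x y t : R) :
  0 < t -> t < 1 -> m <= x -> m <= y -> m = t * x + (1 - t) * y ->
  x = m /\ y = m.
Proof. by move=> *; split; nra. Qed.

Lemma conv_eq_max (R : realFieldType) (m x y t : R) :
  0 < t -> t < 1 -> x <= m -> y <= m -> m = t * x + (1 - t) * y ->
  x = m /\ y = m.
Proof. by move=> *; split; nra. Qed.

(** * Points and the enclosing region *)

(** The second component is a constant function: T is a singleton wherever
    this point is used. *)
Definition arc_point (R : realType) (Q T : finType) (A : {set Q}) (k : R) :
    arc_space R Q T :=
  ([ffun q => (q \in A)%:R], [ffun=> k]).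
Arguments arc_point {R Q} T A k.

Definition step_region (R : realType) (Q T : finType) (t1 : T) (r : R) :
    set (arc_space R Q T) :=
  [set z : arc_space R Q T | forall q,
    0 <= (z.1 q : R) <= 1 /\ (z.1 q : R) <= (z.2 t1 : R) - r]%classic.
Arguments step_region {R} Q {T} t1 r.

Lemma dotf_single (R : realType) (T : finType) (t1 : T) (u v : T -> R) :
  (forall t, t = t1) -> dotf u v = u t1 * v t1.
Proof.
by move=> hT; rewrite /dotf (bigD1 t1) //= big1 ?addr0 // => t; rewrite (hT t) eqxx.
Qed.

Lemma dotf_indicator (R : realType) (I : finType) (A : {set I}) (v : I -> R) :
  dotf (fun i => (i \in A)%:R) v = \sum_(i in A) v i.
Proof.
rewrite /dotf [RHS]big_mkcond; apply: eq_bigr => i _.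
by case: ifP; rewrite ?mul1r ?mul0r.
Qed.

Lemma dotf_pred1 (R : realType) (I : finType) (i : I) (v : I -> R) :
  dotf (fun j => (j == i)%:R) v = v i.
Proof.
rewrite /dotf (bigD1 i) //= eqxx mul1r big1 ?addr0 // => j /negPf->.
by rewrite mul0r.
Qed.

Lemma dotfC (R : realType) (I : finType) (u v : I -> R) : dotf u v = dotf v u.
Proof. by apply: eq_bigr => i _; rewrite mulrC. Qed.

Lemma dotf_pred1r (R : realType) (I : finType) (i : I) (v : I -> R) :
  dotf v (fun j => (j == i)%:R) = v i.
Proof. by rewrite dotfC dotf_pred1. Qed.

Lemma dotf_arc_point (R : realType) (Q T : finType) (A : {set Q}) (k : R)
    (v : Q -> R) :
  dotf (arc_point T A k).1 v = \sum_(q in A) v q.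
Proof. by rewrite -dotf_indicator; apply: eq_bigr => q _; rewrite ffunE. Qed.

Lemma convex_step_region (R : realType) (Q T : finType) (t1 : T) (r : R)
    (u v : arc_space R Q T) (s t : R) :
  0 <= s -> 0 <= t -> s + t = 1 ->
  step_region Q t1 r u -> step_region Q t1 r v ->
  step_region Q t1 r (s *: u + t *: v).
Proof.
move=> s0 t0 st hu hv q; have [/andP[u0 u1] u2] := hu q.
have [/andP[v0 v1] v2] := hv q; rewrite /= !ffunE.
change ((0 <= s * (u.1 q : R) + t * (v.1 q : R) <= 1) /\
  s * (u.1 q : R) + t * (v.1 q : R) <=
    s * (u.2 t1 : R) + t * (v.2 t1 : R) - r).
move: (u.1 q : R) (v.1 q : R) (u.2 t1 : R) (v.2 t1 : R) u0 u1 u2 v0 v1 v2.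
move=> x x' y y' u0 u1 u2 v0 v1 v2.
split; first (apply/andP; split); nra.
Qed.

(** The capacity condition forces y >= r by minimality of r. If moreover some
    x_q = 1, then y = r is excluded because b r + c < a_q, so integrality
    improves y >= r to y >= r + 1. *)
Lemma arc_polyhedron_sub_step (R : realType) (Q T : finType) (t1 : T)
    (a : Q -> R) (b : T -> R) (c : R) (r : nat)
    (hT : forall t : T, t = t1) (ha : forall q, 0 < a q)
    (hmin : forall k : nat, 0 <= b t1 * k%:R + c -> (r <= k)%N)
    (hbr : forall q, b t1 * r%:R + c < a q) :
  (arc_polyhedron a b c `<=` step_region Q t1 r%:R)%classic.
Proof.
apply: conv_hull_sub; last exact: convex_step_region.
move=> [x y] [/= x01 ynat hxy] q.
have /natrP[k yk] := ynat t1.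
move: hxy; rewrite (dotf_single _ _ hT) //= yk => hxy.
have ax0 p : 0 <= a p * (x p : R).
  apply: mulr_ge0; first exact: ltW.
  by case: (x01 p) => ->; rewrite ?lexx ?ler01.
have rk : (r <= k)%N by apply: hmin; apply: le_trans hxy; exact: sumr_ge0.
split; first by case: (x01 q) => ->; rewrite ?lexx ?ler01.
case: (x01 q) => xq; rewrite xq; first by rewrite subr_ge0 ler_nat.
suff : (r < k)%N by move=> rk'; rewrite lerBrDr [1 + _]addrC natr1 ler_nat.
rewrite ltn_neqAle rk andbT; apply/eqP => rkE.
have := hbr q; rewrite rkE ltNge => /negP; apply; apply: le_trans hxy.
rewrite /dotf (bigD1 q) //= xq mulr1 lerDl; exact: sumr_ge0.
Qed.

Lemma arc_polyhedron_empty (R : realType) (Q T : finType) (t1 : T)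
    (a : Q -> R) (b : T -> R) (c : R) (r : nat)
    (hT : forall t : T, t = t1) (h0 : 0 <= b t1 * r%:R + c) :
  arc_polyhedron a b c (arc_point T finset.set0 r%:R).
Proof.
apply: sub_gen_smallest; split.
- by move=> q; left; rewrite ffunE inE.
- by move=> t; rewrite ffunE natr_nat.
by rewrite dotfC dotf_arc_point big_set0 (dotf_single _ _ hT) //= ffunE.
Qed.

Lemma arc_polyhedron_next (R : realType) (Q T : finType) (t1 : T)
    (a : Q -> R) (b : T -> R) (c : R) (r : nat)
    (hT : forall t : T, t = t1) (ha : forall q, 0 < a q)
    (hsum : \sum_q a q <= b t1 * (r%:R + 1) + c) (A : {set Q}) :
  arc_polyhedron a b c (arc_point T A (r%:R + 1)).
Proof.
apply: sub_gen_smallest; split.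
- by move=> q; rewrite ffunE; case: (q \in A); [right|left].
- by move=> t; rewrite ffunE natr1 natr_nat.
rewrite dotfC dotf_arc_point (dotf_single _ _ hT) //= ffunE; apply: le_trans hsum.
rewrite [leRHS](bigID (mem A)) /= lerDl; apply: sumr_ge0 => q _; exact: ltW.
Qed.

(** * Vertices and separation *)

Section Step.

Context (R : realType) (Q T : finType) (t1 : T) (r : R)
  (P : set (arc_space R Q T)).
Hypothesis hT : forall t : T, t = t1.
Hypothesis hP : (P `<=` step_region Q t1 r)%classic.
Hypothesis hP0 : P (arc_point T finset.set0 r).
Hypothesis hP1 : forall A : {set Q}, P (arc_point T A (r + 1)).

Lemma arc_spaceP (u v : arc_space R Q T) :
  (forall q, u.1 q = v.1 q) -> u.2 t1 = v.2 t1 -> u = v.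
Proof.
case: u v => [x y] [x' y'] /= xx' yy'; congr pair; apply/ffunP => i //.
by rewrite (hT i).
Qed.

(** The bounds 0 <= x_q are attained at (0, r), and then y >= r + x_d is too.
    The element d only witnesses that Q is nonempty, without which y would be
    unbounded below in the region. *)
Lemma vertex_empty (d : Q) : is_vertex P (arc_point T finset.set0 r).
Proof.
split=> // u w t /hP Pu /hP Pw t0 t1' e.
have hq q : (0 : R) = t * (u.1 q : R) + (1 - t) * (w.1 q : R).
  by have := congr1 (fun z : arc_space R Q T => z.1 q) e; rewrite /= !ffunE inE.
have hy : r = t * (u.2 t1 : R) + (1 - t) * (w.2 t1 : R).
  by have := congr1 (fun z : arc_space R Q T => z.2 t1) e; rewrite /= !ffunE.
have hx q : u.1 q = 0 /\ w.1 q = 0.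
  have [/andP[u0 _] _] := Pu q; have [/andP[w0 _] _] := Pw q.
  exact: conv_eq_min (hq q).
have [_ ud] := Pu d; have [_ wd] := Pw d.
rewrite (hx d).1 subr_ge0 in ud; rewrite (hx d).2 subr_ge0 in wd.
have yy : u.2 t1 = r /\ w.2 t1 = r.
  exact: conv_eq_min hy.
by split; apply: arc_spaceP => [q|]; rewrite !ffunE ?inE ?(hx q).1 ?(hx q).2 ?yy.1 ?yy.2.
Qed.

(** Each x_q sits at one of its bounds 0 and 1, which fixes the x part of both
    endpoints; then y >= r + x_d = r + 1 is attained for any d in A. *)
Lemma vertex_next (A : {set Q}) :
  A != finset.set0 -> is_vertex P (arc_point T A (r + 1)).
Proof.
move=> /finset.set0Pn[d dA]; split=> // u w t /hP Pu /hP Pw t0 t1' e.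
have hq q : ((q \in A)%:R : R) = t * (u.1 q : R) + (1 - t) * (w.1 q : R).
  by have := congr1 (fun z : arc_space R Q T => z.1 q) e; rewrite /= !ffunE.
have hy : r + 1 = t * (u.2 t1 : R) + (1 - t) * (w.2 t1 : R).
  by have := congr1 (fun z : arc_space R Q T => z.2 t1) e; rewrite /= !ffunE.
have hx q : u.1 q = (q \in A)%:R /\ w.1 q = (q \in A)%:R.
  have [/andP[u0 u1] _] := Pu q; have [/andP[w0 w1] _] := Pw q.
  have := hq q; case: (q \in A) => e'.
    exact: conv_eq_max e'.
  exact: conv_eq_min e'.
have [_ ud] := Pu d; have [_ wd] := Pw d.
rewrite (hx d).1 dA lerBrDr addrC in ud; rewrite (hx d).2 dA lerBrDr addrC in wd.
have yy : u.2 t1 = r + 1 /\ w.2 t1 = r + 1.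
  exact: conv_eq_min hy.
by split; apply: arc_spaceP => [q|]; rewrite !ffunE ?(hx q).1 ?(hx q).2 ?yy.1 ?yy.2.
Qed.

Lemma step_valid (d : Q) :
  valid_inequality P (fun q => (q == d)%:R) (fun t => (t == t1)%:R) (- r).
Proof. by move=> z /hP /(_ d) [_ hz]; rewrite !dotf_pred1. Qed.

(** The weak duality estimate: a feasible (alpha, beta, gamma) is bounded by
    combining just two of its constraints, with weights 1 - m and m. *)
Lemma step_solves (zbar : arc_space R Q T) (d : Q) :
  (forall q, 0 <= (zbar.1 q : R) <= 1) ->
  (forall q, (zbar.1 q : R) <= zbar.1 d) ->
  solves_separation P t1 zbar
    (fun q => (q == d)%:R) (fun t => (t == t1)%:R) (- r).
Proof.
move=> zbox zmax; split.
  split=> [v [Pv _]||t]; [|by rewrite eqxx|by rewrite (hT t) eqxx].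
  have := step_valid d Pv.
  by rewrite !dotf_pred1 !dotf_pred1r -subr_le0 opprD addrA.
move=> al be ga [hv be1 _]; rewrite /separation_objective.
rewrite !dotf_pred1r (dotf_single _ be hT) be1 mulr1.
have low : - r - ga <= 0.
  have := hv _ (vertex_empty d).
  by rewrite dotf_arc_point big_set0 (dotf_single _ _ hT) // be1 ffunE; lra.
pose A := [set q | 0 < al q].
(* When A is empty (1_A, r + 1) is not a vertex, but the bound then follows
   from low. *)
have up : \sum_(q in A) al q <= r + 1 + ga.
  have [->|A0] := eqVneq A finset.set0; first by rewrite big_set0; lra.
  have := hv _ (vertex_next A0).
  by rewrite dotf_arc_point (dotf_single _ _ hT) // be1 ffunE; lra.
have sumA : dotf zbar.1 al <= (zbar.1 d : R) * \sum_(q in A) al q.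
  rewrite mulr_sumr [leRHS]big_mkcond; apply: ler_sum => q _; rewrite inE.
  case: ltP => [al0|al0]; first by rewrite ler_wpM2r // ltW.
  by rewrite mulr_ge0_le0 //; case/andP: (zbox q).
have /andP[m0 m1] := zbox d.
move: (zbar.1 d : R) (\sum_(q in A) al q) (dotf zbar.1 al) (zbar.2 t1 : R)
  m0 m1 up sumA => m s x y *.
nra.
Qed.

(** * The facet *)

Definition facet_dirs (d : Q) : seq (arc_space R Q T) :=
  [seq arc_point T [set d; q] 1 | q : Q].

(** A vector (x, y) with x_d = y has coordinates x_q on (1_{d,q}, 1) for
    q != d; the coordinate on (1_{d}, 1) is what makes them add up to x_d. *)
Lemma facet_dirs_span (d : Q) (z : arc_space R Q T) :
  (z.1 d : R) = z.2 t1 -> z \in <<facet_dirs d>>%VS.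
Proof.
move=> zd.
pose co q : R := if q == d then z.1 d - \sum_(p | p != d) (z.1 p : R) else z.1 q.
have sumco : \sum_q co q = z.1 d.
  rewrite (bigD1 d) //= {1}/co eqxx -[RHS](subrK (\sum_(p | p != d) (z.1 p : R))).
  by congr +%R; apply: eq_bigr => p /negPf; rewrite /co => ->.
have -> : z = \sum_q co q *: arc_point T [set d; q] 1.
  have S1 p : (\sum_q co q *: arc_point T [set d; q] 1).1 p
     = \sum_q co q * (p \in [set d; q])%:R.
    rewrite (raddf_sum (@fst _ _)) sum_ffunE; apply: eq_bigr => q _.
    by rewrite /= !ffunE.
  have S2 : (\sum_q co q *: arc_point T [set d; q] 1).2 t1 = \sum_q co q.
    rewrite (raddf_sum (@snd _ _)) sum_ffunE; apply: eq_bigr => q _.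
    by rewrite /= !ffunE; exact: mulr1.
  apply: arc_spaceP => [p|]; last by rewrite S2 sumco.
  rewrite S1; have [->|pd] := eqVneq p d.
    rewrite -[LHS]sumco; apply: eq_bigr => q _; by rewrite !inE eqxx mulr1.
  rewrite (bigD1 p) //= big1 => [|q qp]; last first.
    by rewrite !inE (negPf pd) eq_sym (negPf qp) mulr0.
  by rewrite !inE eqxx orbT mulr1 addr0 /co (negPf pd).
apply: memv_suml => q _; apply: memvZ; apply: memv_span.
by apply: map_f; rewrite mem_enum.
Qed.

(** It is enough to span: the family has |Q| + 1 elements, the dimension of
    the space. Subtracting a multiple of (0, 1) moves any vector into the
    hyperplane x_d = y. *)
Lemma basis_dirs (d : Q) : basis_of fullv (arc_point T finset.set0 1 :: facet_dirs d).
Proof.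
have T1 : #|T| = 1%N by apply/eqP/fintype1P; exists t1.
rewrite basisEdim; apply/andP; split; last first.
  rewrite dimvf /= /facet_dirs size_map -cardE.
  change (#|Q| < #|Q| * 1 + #|T| * 1)%N.
  by rewrite T1 !muln1 addn1.
apply/subvP => z _; rewrite span_cons.
pose e : R := (z.2 t1 : R) - z.1 d.
rewrite -[z](subrK (e *: arc_point T finset.set0 1)) addrC memv_add //.
  by rewrite memvZ ?memv_line.
apply: facet_dirs_span; rewrite /= !ffunE inE /e.
change ((z.1 d : R) - (z.2 t1 - z.1 d) * 0 = (z.2 t1 : R) - (z.2 t1 - z.1 d) * 1).
move: (z.1 d : R) (z.2 t1 : R) => x y; lra.
Qed.

Lemma step_facet (d : Q) :
  defines_facet P (fun q => (q == d)%:R) (fun t => (t == t1)%:R) (- r).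
Proof.
split; first exact: step_valid.
have freeB := basis_free (basis_dirs d).
have addp (A : {set Q}) : arc_point T finset.set0 r + arc_point T A 1 = arc_point T A (r + 1).
  by apply: arc_spaceP => [q|]; rewrite /= !ffunE ?inE ?add0r.
exists (size (facet_dirs d)); split.
  apply: (has_dim_free (p := arc_point T finset.set0 r)
    (X := arc_point T finset.set0 1 :: facet_dirs d)) => //.
  - move=> v; rewrite inE => /predU1P[->|/mapP[q _ ->]]; rewrite addp; exact: hP1.
  - by move=> u v _ _; rewrite (span_basis (basis_dirs d)) memvf.
apply: (has_dim_free (p := arc_point T finset.set0 r)).
- split=> //=; by rewrite !dotf_pred1 !ffunE inE subrr.
- move=> v /mapP[q _ ->]; rewrite addp; split; first exact: hP1.
  by rewrite /= !dotf_pred1 !ffunE !inE eqxx addrC addKr.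
- by move: freeB; rewrite free_cons => /andP[].
move=> u v [_ /= ue] [_ /= ve]; apply: facet_dirs_span.
rewrite /= !ffunE; move: ue ve; rewrite !dotf_pred1 => -> ->.
by rewrite opprD addrACA subrr addr0.
Qed.

End Step.

Theorem proposition5 (R : realType) (Q T : finType) (t1 : T)
    (a : Q -> R) (b : T -> R) (c : R) (zbar : arc_space R Q T) (r : int) (d : Q)
    (hQ : (0 < #|Q|)%N)
    (hT : forall t : T, t = t1)
    (hb : 0 < b t1)
    (ha : forall q : Q, 0 < a q)
    (hac : 0 < \sum_(q : Q) a q - c)
    (hr : r = Num.max (Num.ceil (- c / b t1)) 0)
    (hd : forall q : Q, (zbar.1 q : R) <= zbar.1 d)
    (hz : arc_set_LP a b c zbar)
    (hab : forall q : Q, a q <= b t1)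
    (hbr : forall q : Q, b t1 * r%:~R + c < a q)
    (hsum : \sum_(q : Q) a q <= b t1 * (r%:~R + 1) + c) :
  solves_separation (arc_polyhedron a b c) t1 zbar
    (fun q : Q => (q == d)%:R) (fun t : T => (t == t1)%:R) (- r%:~R) /\
  defines_facet (arc_polyhedron a b c)
    (fun q : Q => (q == d)%:R) (fun t : T => (t == t1)%:R) (- r%:~R).
Proof.
(* The integer r is characterised as the least k >= 0 with b k + c >= 0. *)
have min_r (k : int) : 0 <= k -> (0 <= b t1 * k%:~R + c) = (r <= k).
  move=> k0; rewrite hr ge_max k0 andbT ceil_le_int.
  by rewrite ler_pdivrMr // [b t1 * _]mulrC -[- c <= _]subr_ge0 opprK.
have r0 : 0 <= r by rewrite hr le_max lexx orbT.
case: r r0 min_r {hr} hbr hsum => // r _ min_r hbr hsum.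
have sub := arc_polyhedron_sub_step hT ha
  (fun k => etrans (esym (min_r k isT))) hbr.
have P0 : arc_polyhedron a b c (arc_point T finset.set0 r%:R).
  by apply: (arc_polyhedron_empty hT); rewrite (min_r r).
have P1 := arc_polyhedron_next hT ha hsum.
case: hz => zbox _ _.
by split; [apply: step_solves|apply: step_facet].
Qed.
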